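(* Let $\mathcal T=\{T_1,\dots,T_m\}\subset\mathbb C^{d\times d}$ be a family of matrices that are all upper triangular or all lower triangular, with nonzero diagonal entries $(T_i)_{jj}=\lambda_j^{(i)}$, and with probability weights $p_1,\dots,p_m$. Assume there exists $j^\star\in\{1,\dots,d\}$ such that $|\lambda_{j^\star}^{(i)}|>\max_{j\ne j^\star}|\lambda_j^{(i)}|$ for all $i=1,\dots,m$. Define $$\Lambda(t):=\log\sum_{i=1}^m p_i|\lambda_{j^\star}^{(i)}|^t\quad(t\in\mathbb R),\qquad I(z):=\sup_{t\in\mathbb R}\bigl(tz-\Lambda(t)\bigr)\quad(z\in\mathbb R).$$ Then $\rho_n$ satisfies a large deviation principle with speed $n$ and good rate function $\widetilde I(r):=I(\log r)$, $r>0$; that is, for any Borel set $B\subseteq(0,\infty)$, $$-\inf_{r\in B^\circ}\widetilde I(r)\le\liminf_{n\to\infty}\frac1n\log\mathbb P(\rho_n\in B)\le\limsup_{n\to\infty}\frac1n\log\mathbb P(\rho_n\in B)\le-\inf_{r\in\overline B}\widetilde I(r).$$ Moreover, $I\ge0$ and $I(\log\rho_\infty)=0$, where $\rho_\infty=\prod_{i=1}^m|\lambda_{j^\star}^{(i)}|^{p_i}$. Let $Z$ be the random variable taking the value $\log|\lambda_{j^\star}^{(i)}|$ with probability $p_i$. If $Z$ is non-degenerate (not almost surely constant), then $I$ is strictly convex on the interior of its effective domain $\{I<\infty\}$. If $Z$ is degenerate, then $I$ is $0$ at $\log\rho_\infty$ and $+\infty$ away from this point.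
   Context: $\mathbb P_{\mathcal T}$ assigns mass $p_i\ge 0$ to $T_i$, with $\sum_i p_i=1$. Let $(i_k)_{k\ge1}$ be i.i.d. random indices in $\{1,\dots,m\}$ with $\mathbb P(i_k=i)=p_i$. The random spectral radius of length $n$ is $\rho_n:=\rho(T_{i_n}\cdots T_{i_1})^{1/n}$, where $\rho(\cdot)$ is the spectral radius. $B^\circ$ and $\overline B$ denote interior and closure in $(0,\infty)$; a good rate function is a lower semicontinuous $[0,\infty]$-valued function with compact sublevel sets; $\inf\emptyset=+\infty$ and $\log 0=-\infty$. *)

(* Defs.v *)
From mathcomp Require Import all_boot all_order all_algebra.
From mathcomp Require Import all_classical all_reals all_analysis.
From mathcomp Require Import complex.

Set Implicit Arguments.
Unset Strict Implicit.
Unset Printing Implicit Defensive.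

Import Order.TTheory GRing.Theory Num.Theory.
Import numFieldNormedType.Exports.
Import ComplexField.

Local Open Scope classical_set_scope.
Local Open Scope ring_scope.

(** The modulus as a real number; in [R[i]] itself, [`|z|] lies in [R[i]]. *)
Notation modC := Normc.normc.

Definition spectral_radius (R : realType) (d : nat) (A : 'M[R[i]]_d) : R :=
  sup [set modC a | a in [set a : R[i] | eigenvalue A a]].

(** [T_(i_n) *m ... *m T_(i_1)], the index [i_(k+1)] being [idx k]. *)
Fixpoint random_product (R : realType) (d m : nat) (T : 'I_m -> 'M[R[i]]_d)
    (Omega : Type) (idx : nat -> Omega -> 'I_m) (n : nat) (w : Omega) :
    'M[R[i]]_d :=
  if n is k.+1 then T (idx k w) *m random_product T idx k w else 1%:M.

Definition random_spectral_radius (R : realType) (d m : nat)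
    (T : 'I_m -> 'M[R[i]]_d) (Omega : Type) (idx : nat -> Omega -> 'I_m)
    (n : nat) (w : Omega) : R :=
  spectral_radius (random_product T idx n w) `^ (n%:R^-1).

(** [I] carries the sigma-algebra of all its subsets. *)
Definition discrete_random_variable (dO : measure_display)
    (Omega : measurableType dO) (I : Type) (X : Omega -> I) : Prop :=
  forall A : set I, measurable (X @^-1` A).

Definition mutually_independent (R : realType) (dO : measure_display)
    (Omega : measurableType dO) (P : probability Omega R) (I : Type)
    (X : nat -> Omega -> I) : Prop :=
  forall (J : seq nat) (A : nat -> set I), uniq J ->
    P (\bigcap_(k in [set` J]) (X k @^-1` A k)) =
    (\prod_(k <- J) P (X k @^-1` A k))%E.

Definition iid_indices (R : realType) (dO : measure_display)
    (Omega : measurableType dO) (P : probability Omega R) (m : nat)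
    (p : 'I_m -> R) (idx : nat -> Omega -> 'I_m) : Prop :=
  [/\ forall k, discrete_random_variable (idx k),
      mutually_independent P idx &
      forall k i, P (idx k @^-1` [set i]) = (p i)%:E].

(** [J] is only considered on [D].  Lower semicontinuity is relative to [D]:
    points outside [D] are isolated in [subspace D]. *)
Definition good_rate_function (R : realType) (D : set R) (J : R -> \bar R) :
    Prop :=
  [/\ forall x, D x -> (0 <= J x)%E,
      @lower_semicontinuous (subspace D) R J &
      forall a : R, compact [set x | D x /\ (J x <= a%:E)%E]].

(** Large deviation principle on the space [D] for the laws of [X n], with
    speed [s n].  Interior and closure are taken in [D] with its subspace
    topology; as [B] is contained in [D], the points outside [D], isolated in
    [subspace D], lie in neither of them. *)
Definition large_deviation_principle (R : realType) (dO : measure_display)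
    (Omega : measurableType dO) (P : probability Omega R) (D : set R)
    (X : nat -> Omega -> R) (s : nat -> R) (J : R -> \bar R) : Prop :=
  forall B : set R, measurable B -> B `<=` D ->
    let u := fun n => (((s n)^-1)%:E * lne (P (X n @^-1` B)))%E in
    [/\ (- ereal_inf [set J x | x in @interior (subspace D) B]
           <= limn_einf u)%E,
        (limn_einf u <= limn_esup u)%E &
        (limn_esup u
           <= - ereal_inf [set J x | x in @closure (subspace D) B])%E].

Definition effective_domain (R : realType) (f : R -> \bar R) : set R :=
  [set x | (f x < +oo)%E].

Definition strictly_convex_on (R : realType) (S : set R) (f : R -> \bar R) :
    Prop :=
  forall x y t : R, S x -> S y -> x != y -> 0 < t < 1 ->
    (f (t * x + (1 - t) * y)%R < t%:E * f x + (1 - t)%:E * f y)%E.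

Definition degenerate (R : realType) (dO : measure_display)
    (Omega : measurableType dO) (P : probability Omega R) (Z : Omega -> R) :
    Prop :=
  exists c : R, {ae P, forall w, Z w = c}.

Definition log_mgf (R : realType) (m : nat) (p a : 'I_m -> R) (t : R) : R :=
  ln (\sum_(i < m) p i * a i `^ t).

Definition legendre (R : realType) (L : R -> R) (z : R) : \bar R :=
  ereal_sup (range (fun t : R => (t * z - L t)%:E)).

(* Main.v *)
Require Import Defs.
From mathcomp Require Import all_boot all_order all_algebra.
From mathcomp Require Import all_classical all_reals all_analysis.
From mathcomp Require Import complex.
From mathcomp Require Import ring lra.

Import Order.TTheory GRing.Theory Num.Theory.
Import numFieldNormedType.Exports.

Set Implicit Arguments.
Unset Strict Implicit.
Unset Printing Implicit Defensive.

Local Open Scope classical_set_scope.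
Local Open Scope ring_scope.

(** The eigenvalues of a product of triangular matrices are the products of the
    diagonal entries, and the index [jstar] dominates all of them, so [rho_n] is
    the exponential of the empirical mean of the i.i.d. variables
    [ln (lam (idx k))]; the theorem is Cramer's theorem for a finitely supported
    law.  Upper bound: Chernoff's inequality at the points of the closed set
    nearest to the mean on each side.  Lower bound: exponential tilting with
    Chebyshev's inequality under the tilted law; the tilting parameter is a zero
    of a continuous function, given by the intermediate value theorem.  Convex
    duality needs no differentiation: [1 + u <= expR u], strict for [u != 0],
    says that a zero of the tilted drift is the strict minimum of the centered
    moment generating function. *)

(** Centering at [z] makes the exponent of Cramer's theorem [- ln (mgf p a z t)]
    and turns the equation [Lambda'(t) = z] into [tilted_drift p a z t = 0]. *)
Definition mgf (R : realType) (m : nat) (p a : 'I_m -> R) (z t : R) : R :=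
  \sum_i p i * expR (t * (a i - z)).

Definition tilted_drift (R : realType) (m : nat) (p a : 'I_m -> R) (z t : R) : R :=
  \sum_i p i * (a i - z) * expR (t * (a i - z)).

(** The Legendre transform of [t |-> ln (mgf p a 0 t)], by [ln_mgf]. *)
Definition rate (R : realType) (m : nat) (p a : 'I_m -> R) (z : R) : \bar R :=
  ereal_sup (range (fun t => (- ln (mgf p a z t))%:E)).

(** * The rate function: duality, its zero at the mean, and where it is finite *)

Section Rate.
Variables (R : realType) (m : nat) (p a : 'I_m -> R).
Hypotheses (p_ge0 : forall i, 0 <= p i) (p_sum1 : \sum_i p i = 1).

Let mean := \sum_i p i * a i.

Lemma pos_weight : exists i, 0 < p i.
Proof.
apply: contrapT => np; have : \sum_i p i = 0.
  apply: big1 => i _; apply/eqP; rewrite eq_le p_ge0 andbT leNgt.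
  by apply/negP => pi; apply: np; exists i.
by rewrite p_sum1 => /eqP; rewrite oner_eq0.
Qed.

Lemma sum_weight_gt0 (f : 'I_m -> R) : (forall i, 0 < f i) ->
  0 < \sum_i p i * f i.
Proof.
move=> f0; have [i pi] := pos_weight.
rewrite (bigD1 i)//= ltr_wpDr ?mulr_gt0//.
by apply: sumr_ge0 => j _; rewrite mulr_ge0// ltW.
Qed.

Lemma mgf_gt0 z t : 0 < mgf p a z t.
Proof. by apply: sum_weight_gt0 => i; exact: expR_gt0. Qed.

Lemma mgf0 z : mgf p a z 0 = 1.
Proof.
by rewrite -p_sum1; apply: eq_bigr => i _; rewrite mul0r expR0 mulr1.
Qed.

Lemma mgf_shift z t : mgf p a z t = expR (- (t * z)) * mgf p a 0 t.
Proof.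
rewrite /mgf mulr_sumr; apply: eq_bigr => i _.
by rewrite mulrCA -expRD subr0; congr (_ * expR _); ring.
Qed.

Lemma ln_mgf z t : - ln (mgf p a z t) = t * z - ln (mgf p a 0 t).
Proof.
rewrite mgf_shift lnM ?posrE ?expR_gt0 ?mgf_gt0// expRK; ring.
Qed.

Lemma rate_ub z t : ((- ln (mgf p a z t))%:E <= rate p a z)%E.
Proof. by apply: ereal_sup_ubound; exists t. Qed.

Lemma rate_leP z (c : R) :
  reflect (forall t, - ln (mgf p a z t) <= c) (rate p a z <= c%:E)%E.
Proof.
apply: (iffP idP) => [h t|h].
  by rewrite -lee_fin; exact: le_trans (rate_ub z t) h.
by apply: ge_ereal_sup => _ [t _ <-]; rewrite lee_fin.
Qed.

Lemma rate_gtP z (c : R) : (c%:E < rate p a z)%E ->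
  exists t, c < - ln (mgf p a z t).
Proof. by move=> /ereal_sup_gt[_ [t _ <-]]; rewrite lte_fin; exists t. Qed.

Lemma rate_ge0 z : (0 <= rate p a z)%E.
Proof. by have := rate_ub z 0; rewrite mgf0 ln1 oppr0. Qed.

Lemma rate_fin z : (rate p a z < +oo)%E -> rate p a z = (fine (rate p a z))%:E.
Proof. by move=> h; rewrite fineK// ge0_fin_numE// rate_ge0. Qed.

(* [e^u >= 1 + u] applied to [u = (s - t) (a_i - z)] *)
Lemma mgf_tangent z t s :
  mgf p a z t + (s - t) * tilted_drift p a z t <= mgf p a z s.
Proof.
rewrite /mgf /tilted_drift mulr_sumr -big_split/=; apply: ler_sum => i _.
have -> : s * (a i - z) = t * (a i - z) + (s - t) * (a i - z) by ring.
rewrite expRD.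
have := expR_ge1Dx ((s - t) * (a i - z)).
move: (expR ((s - t) * _)) => y hy.
have := mulr_ge0 (p_ge0 i) (ltW (expR_gt0 (t * (a i - z)))).
set q := p i * _ => q0; rewrite mulrA -/q.
rewrite [p i * (a i - z) * _]mulrAC -/q; nra.
Qed.

(** The termwise inequality of [mgf_tangent] is strict at an atom of positive mass with [a i != z],
    since its exponent [(s - t) * (a i - z)] is nonzero. *)
Lemma mgf_tangent_strict z t s : t != s -> (exists2 i, 0 < p i & a i != z) ->
  mgf p a z t + (s - t) * tilted_drift p a z t < mgf p a z s.
Proof.
move=> ts [i0 pi0 ai0].
rewrite /mgf /tilted_drift mulr_sumr -big_split/=.
have E i : p i * expR (s * (a i - z)) =
    p i * expR (t * (a i - z)) * expR ((s - t) * (a i - z)).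
  by rewrite -mulrA -expRD; congr (_ * expR _); ring.
have F i : p i * expR (t * (a i - z)) +
    (s - t) * (p i * (a i - z) * expR (t * (a i - z))) =
    p i * expR (t * (a i - z)) * (1 + (s - t) * (a i - z)) by ring.
rewrite (eq_bigr _ (fun i _ => F i)) [ltRHS](eq_bigr _ (fun i _ => E i)).
rewrite (bigD1 i0)//= [ltRHS](bigD1 i0)//= ltr_leD//.
  rewrite ltr_pM2l ?mulr_gt0 ?expR_gt0// expR_gt1Dx//.
  by rewrite mulf_neq0 ?subr_eq0// eq_sym.
apply: ler_sum => i _; rewrite ler_wpM2l ?mulr_ge0 ?expR_ge0//.
exact: expR_ge1Dx.
Qed.

(** A zero of the drift removes the linear term of [mgf_tangent], so [t] minimises the moment
    generating function globally and the supremum is attained there. *)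
Lemma rate_tilt z t : tilted_drift p a z t = 0 ->
  rate p a z = (- ln (mgf p a z t))%:E.
Proof.
move=> h; apply/eqP; rewrite eq_le rate_ub andbT; apply/rate_leP => s.
rewrite lerN2 ler_ln ?posrE ?mgf_gt0//.
by have := mgf_tangent z t s; rewrite h mulr0 addr0.
Qed.

Lemma tilted_drift_mean : tilted_drift p a mean 0 = 0.
Proof.
rewrite /tilted_drift; under eq_bigr do rewrite mul0r expR0 mulr1 mulrBr.
by rewrite big_split/= sumrN -mulr_suml p_sum1 mul1r subrr.
Qed.

Lemma rate_mean : rate p a mean = 0%E.
Proof. by rewrite (rate_tilt tilted_drift_mean) mgf0 ln1 oppr0. Qed.

(** For fixed [t] the exponent is affine in the point; it is at most the rate at [x] and at most [0]
    at the mean. *)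
Lemma rate_toward_mean x s : 0 <= s <= 1 ->
  (rate p a ((1 - s) * x + s * mean) <= rate p a x)%E.
Proof.
move=> /andP[s0 s1].
have [->|h] := eqVneq (rate p a x) +oo%E; first by rewrite leey.
rewrite (@rate_fin x) ?ltey//; apply/rate_leP => t.
have hx : - ln (mgf p a x t) <= fine (rate p a x).
  by rewrite -lee_fin -rate_fin ?ltey// rate_ub.
have hm : - ln (mgf p a mean t) <= 0.
  by have := rate_ub mean t; rewrite rate_mean lee_fin.
have r0 : 0 <= fine (rate p a x) by rewrite fine_ge0// rate_ge0.
rewrite (ln_mgf x) in hx; rewrite (ln_mgf mean) in hm; rewrite ln_mgf.
move: hx hm r0.
set L := ln _; set r := fine _ => hx hm r0.
have -> : t * ((1 - s) * x + s * mean) - L =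
    (1 - s) * (t * x - L) + s * (t * mean - L) by ring.
have h1 : (1 - s) * (t * x - L) <= (1 - s) * r by rewrite ler_wpM2l ?subr_ge0.
have h2 : s * (t * mean - L) <= 0 by rewrite mulr_ge0_le0.
have h3 : 0 <= s * r by rewrite mulr_ge0.
lra.
Qed.

(** If [z] exceeded the largest atom of positive mass by [e > 0], then
    [mgf p a z t <= expR (- (t * e))] for [t >= 0], and the exponents would be unbounded. *)
Lemma rate_lty_le_atom z : (rate p a z < +oo)%E -> exists2 i, 0 < p i & z <= a i.
Proof.
move=> h; have [i0 pi0] := pos_weight.
case: (@Order.TotalTheory.arg_maxP _ _ _ i0 (fun i => 0 < p i) a pi0) => i pi imax.
exists i => //; rewrite leNgt; apply/negP => aiz.
pose e := z - a i; have e0 : 0 < e by rewrite /e subr_gt0.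
have r0 : 0 <= fine (rate p a z) by rewrite fine_ge0// rate_ge0.
(* Chosen so that [t * e] is the rate plus one, which contradicts [rate_ub]. *)
pose t := (fine (rate p a z) + 1) / e.
have t0 : 0 <= t by rewrite divr_ge0 ?(ltW e0)// addr_ge0.
have mle : mgf p a z t <= expR (- (t * e)).
  rewrite -[leRHS]mul1r -p_sum1 mulr_suml; apply: ler_sum => j _.
  have [pj|pj] := ltP 0 (p j).
    rewrite ler_wpM2l// ler_expR -mulrN ler_wpM2l//.
    have : a j <= a i by exact: imax.
    by rewrite /e; lra.
  suff -> : p j = 0 by rewrite !mul0r.
  by apply/eqP; rewrite eq_le pj p_ge0.
have := rate_ub z t; rewrite rate_fin// lee_fin.
have : ln (mgf p a z t) <= - (t * e).
  by rewrite -[leRHS]expRK ler_ln ?posrE ?expR_gt0 ?mgf_gt0.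
by rewrite /t divfK ?gt_eqF//; lra.
Qed.

End Rate.

Lemma mgf_opp (R : realType) m (p a : 'I_m -> R) z t :
  mgf p (fun i => - a i) (- z) t = mgf p a z (- t).
Proof. by apply: eq_bigr => i _; congr (_ * expR _); ring. Qed.

(** This reflection turns each statement about the right side of a point into its counterpart on the
    left. *)
Lemma rate_opp (R : realType) m (p a : 'I_m -> R) z :
  rate p (fun i => - a i) (- z) = rate p a z.
Proof.
rewrite /rate; congr ereal_sup; rewrite eqEsubset; split => _ [t _ <-].
  by exists (- t) => //=; rewrite mgf_opp.
by exists (- t) => //=; rewrite mgf_opp opprK.
Qed.

(** * Tilting: solving [tilted_drift p a z t = 0] for [t] *)

Section LowerAtoms.
Variables (R : realType) (m : nat) (p a : 'I_m -> R).
Hypotheses (p_ge0 : forall i, 0 <= p i) (p_sum1 : \sum_i p i = 1).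

Let mean := \sum_i p i * a i.

Lemma rate_lty_ge_atom z : (rate p a z < +oo)%E -> exists2 i, 0 < p i & a i <= z.
Proof.
rewrite -rate_opp => /rate_lty_le_atom-/(_ p_ge0 p_sum1)[i pi].
by rewrite lerN2; exists i.
Qed.

(** For [t >= 0] the atoms below [z] have exponential factors at most [1], so the terms other than
    [i] sum to at least [- c], while the term of [i] grows at least linearly in [t]. *)
Lemma tilted_drift_pos z : (exists2 i, 0 < p i & z < a i) ->
  exists2 t, 0 <= t & 0 < tilted_drift p a z t.
Proof.
move=> [i pi ai].
pose c := \sum_j p j * `|a j - z|.
have c0 : 0 <= c by apply: sumr_ge0 => j _; rewrite mulr_ge0.
have w0 : 0 < p i * (a i - z) by rewrite mulr_gt0// subr_gt0.
(* With this [t], the bound [1 + u <= expR u] gives the term of [i] exactly an extra [c]. *)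
pose t := c / (p i * (a i - z) * (a i - z)).
have t0 : 0 <= t by rewrite divr_ge0// ?mulr_ge0// ?ltW// subr_gt0.
exists t => //.
rewrite /tilted_drift (bigD1 i)//=.
have h1 : p i * (a i - z) + c <= p i * (a i - z) * expR (t * (a i - z)).
  have : p i * (a i - z) * (1 + t * (a i - z)) <=
      p i * (a i - z) * expR (t * (a i - z)).
    by rewrite ler_pM2l// expR_ge1Dx.
  apply: le_trans; rewrite [leRHS]mulrDr mulr1 lerD2l.
  have -> // : p i * (a i - z) * (t * (a i - z)) = c.
  by rewrite /t; field; rewrite subr_eq0 !gt_eqF.
have h2 : - c <= \sum_(j | j != i) p j * (a j - z) * expR (t * (a j - z)).
  apply: (@le_trans _ _ (- \sum_(j | j != i) p j * `|a j - z|)).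
    rewrite lerN2 /c [leRHS](bigD1 i)//= lerDr mulr_ge0//.
  rewrite -sumrN; apply: ler_sum => j _.
  rewrite -mulrN -mulrA ler_wpM2l//.
  have [h|h] := leP 0 (a j - z).
    by rewrite (@le_trans _ _ 0) ?oppr_le0// mulr_ge0// expR_ge0.
  rewrite ltr0_norm// opprK -[leLHS]mulr1 ler_nM2l// -expR0 ler_expR.
  by rewrite mulr_ge0_le0// ltW.
lra.
Qed.

End LowerAtoms.

Lemma tilted_drift_opp (R : realType) m (p a : 'I_m -> R) z t :
  tilted_drift p (fun i => - a i) (- z) t = - tilted_drift p a z (- t).
Proof.
rewrite /tilted_drift -sumrN; apply: eq_bigr => i _.
have -> : t * (- a i - - z) = - t * (a i - z) by ring.
by ring.
Qed.

(** Up to a positive factor the drift is affine in [z] with slope [- mgf p a 0 t], which is what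
    [tilt_inj] exploits. *)
Lemma tilted_drift_shift (R : realType) m (p a : 'I_m -> R) z t :
  tilted_drift p a z t = expR (- (t * z)) *
    (\sum_i p i * a i * expR (t * a i) - z * mgf p a 0 t).
Proof.
rewrite /tilted_drift /mgf mulr_sumr -sumrB mulr_sumr.
apply: eq_bigr => i _.
have -> : t * (a i - z) = - (t * z) + t * a i by ring.
by rewrite expRD subr0; ring.
Qed.

Lemma continuous_tilted_drift (R : realType) m (p a : 'I_m -> R) z :
  continuous (tilted_drift p a z).
Proof.
move=> t; apply: cvg_big => [|i _]; first exact: add_continuous.
apply: cvgM; first exact: cvg_cst.
apply: continuous_comp; last exact: continuous_expR.
by apply: cvgM; [exact: cvg_id|exact: cvg_cst].
Qed.

Section Tilting.
Variables (R : realType) (m : nat) (p a : 'I_m -> R).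
Hypotheses (p_ge0 : forall i, 0 <= p i) (p_sum1 : \sum_i p i = 1).

Let mean := \sum_i p i * a i.

(** An atom above [z] makes the drift positive at some [t >= 0]; by reflection an atom below makes
    it negative at some [- s <= 0]. The intermediate value theorem does the rest. *)
Lemma tilt_exists z : (exists2 i, 0 < p i & a i < z) ->
  (exists2 i, 0 < p i & z < a i) -> exists t, tilted_drift p a z t = 0.
Proof.
move=> [i pi ai] /(tilted_drift_pos p_ge0)[t t0 ht].
have : exists2 i, 0 < p i & - z < - a i by exists i => //; rewrite ltrN2.
move=> /(@tilted_drift_pos _ _ p (fun i => - a i) p_ge0)[s s0].
rewrite tilted_drift_opp oppr_gt0 => hs.
have st : - s <= t by apply: le_trans t0; rewrite oppr_le0.
have [] := @IVT _ (tilted_drift p a z) _ _ 0 st.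
- exact/continuous_subspaceT/continuous_tilted_drift.
- by rewrite minElt maxElt; have -> := lt_trans hs ht; rewrite !ltW.
- by move=> u _ hu; exists u.
Qed.

(** Both points equal the mean of the law with weights proportional to [p i * expR (t * a i)]. *)
Lemma tilt_inj x z t : tilted_drift p a x t = 0 -> tilted_drift p a z t = 0 ->
  x = z.
Proof.
rewrite !tilted_drift_shift => /eqP + /eqP; rewrite !mulf_eq0.
rewrite !(gt_eqF (expR_gt0 _))/= !subr_eq0 => /eqP-> /eqP.
by apply: mulIf; rewrite gt_eqF// mgf_gt0.
Qed.

Lemma rate_gt_off_tilt x t s : tilted_drift p a x t = 0 -> t != s ->
  (exists2 i, 0 < p i & x < a i) ->
  - ln (mgf p a x s) < - ln (mgf p a x t).
Proof.
move=> h ts [i pi ai]; rewrite ltrN2 ltr_ln ?posrE ?mgf_gt0//.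
have := @mgf_tangent_strict _ _ p a p_ge0 x _ _ ts.
rewrite h mulr0 addr0; apply; exists i => //.
by rewrite gt_eqF.
Qed.

(** The convex combination is at most [Num.max x y], and the larger of the two given atoms exceeds
    that maximum. *)
Lemma exists_atom_gt_conv (x y w : R) : 0 <= w <= 1 ->
  (exists2 i, 0 < p i & x < a i) -> (exists2 i, 0 < p i & y < a i) ->
  exists2 i, 0 < p i & w * x + (1 - w) * y < a i.
Proof.
move=> /andP[w0 w1] [i pi xi] [j pj yj].
have : w * x + (1 - w) * y <= Num.max x y.
  rewrite -[leRHS](_ : w * Num.max x y + (1 - w) * Num.max x y = _); last ring.
  by rewrite lerD// ler_wpM2l ?subr_ge0// le_max lexx ?orbT.
move=> /le_lt_trans xy; have [ij|ij] := leP (a i) (a j).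
  by exists j => //; apply: xy; rewrite gt_max yj (lt_le_trans xi).
by exists i => //; apply: xy; rewrite gt_max xi (lt_trans yj).
Qed.

(** Otherwise all weighted deviations [p j * (mean - a j)] would be nonnegative with sum zero, hence
    all zero. *)
Lemma mean_lt_atom : (exists2 i, 0 < p i & a i != mean) ->
  exists2 i, 0 < p i & mean < a i.
Proof.
move=> [i pi ai]; apply: contrapT => no.
have nle j : 0 <= p j * (mean - a j).
  have [pj|pj] := ltP 0 (p j).
    rewrite mulr_ge0// subr_ge0 leNgt; apply/negP => aj.
    by apply: no; exists j.
  have -> : p j = 0 by apply/eqP; rewrite eq_le pj p_ge0.
  by rewrite mul0r.
have /eqP : \sum_j p j * (mean - a j) = 0.
  under eq_bigr do rewrite mulrBr.
  by rewrite sumrB -mulr_suml p_sum1 mul1r subrr.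
rewrite psumr_eq0// => /allP/(_ i); rewrite mem_index_enum => /(_ isT).
by rewrite /= mulf_eq0 gt_eqF//= subr_eq0 eq_sym (negbTE ai).
Qed.

End Tilting.

(** * Shape of the rate: degenerate case, strict convexity, compact sublevel sets *)

Section RateShape.
Variables (R : realType) (m : nat) (p a : 'I_m -> R).
Hypotheses (p_ge0 : forall i, 0 <= p i) (p_sum1 : \sum_i p i = 1).

Let mean := \sum_i p i * a i.

Lemma exists_atom_lt_conv (x y w : R) : 0 <= w <= 1 ->
  (exists2 i, 0 < p i & a i < x) -> (exists2 i, 0 < p i & a i < y) ->
  exists2 i, 0 < p i & a i < w * x + (1 - w) * y.
Proof.
move=> w01 [i pi xi] [j pj yj].
have [||k pk] := @exists_atom_gt_conv _ _ p (fun i => - a i) (- x) (- y) w w01.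
- by exists i => //; rewrite ltrN2.
- by exists j => //; rewrite ltrN2.
by rewrite !mulrN -opprD ltrN2; exists k.
Qed.

Lemma atom_lt_mean : (exists2 i, 0 < p i & a i != mean) ->
  exists2 i, 0 < p i & a i < mean.
Proof.
move=> [i pi ai].
have meanN : \sum_j p j * - a j = - mean.
  by under eq_bigr do rewrite mulrN; rewrite sumrN.
have [|j pj] := @mean_lt_atom _ _ p (fun i => - a i) p_ge0 p_sum1.
  by exists i => //; rewrite meanN eqr_opp.
by rewrite meanN ltrN2; exists j.
Qed.

(** A finite rate puts [z] between two atoms of positive mass, which here coincide with the mean. *)
Lemma rate_degenerate z : (forall i, 0 < p i -> a i = mean) -> z != mean ->
  rate p a z = +oo%E.
Proof.
move=> h zm; apply/eqP; rewrite -leye_eq leNgt; apply/negP => hz.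
have [i pi zi] := rate_lty_le_atom p_ge0 p_sum1 hz.
have [j pj zj] := rate_lty_ge_atom p_ge0 p_sum1 hz.
move: zi zj zm; rewrite !h// => zi zj.
by rewrite eq_le zi zj.
Qed.

(* At an end point of the support no tilt exists: [x] is first moved slightly
   towards the mean, which does not increase the rate. *)
Lemma tilt_near_rate x (e : R) : 0 < e -> (rate p a x < +oo)%E ->
  exists x' t, [/\ `|x' - x| < e, (rate p a x' <= rate p a x)%E &
    tilted_drift p a x' t = 0].
Proof.
move=> e0 hx; have [nd|nd] := pselect (exists2 i, 0 < p i & a i != mean).
  (* The bound [1 / 2] keeps [1 - s] positive; the other one makes the displacement [s * (mean - x)]
     smaller than [e]. *)
  pose s := Num.min (1 / 2) (e / (2 * (`|mean - x| + 1))).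
  have n0 : 0 < `|mean - x| + 1 by rewrite ltr_wpDl.
  have s0 : 0 < s by rewrite lt_min !divr_gt0// mulr_gt0.
  have s1 : s <= 1 / 2 by rewrite ge_min lexx.
  have lt_conv b y z : b <= y -> b < z -> b < (1 - s) * y + s * z.
    move=> b_y bz; have : (1 - s) * b <= (1 - s) * y.
      by rewrite ler_wpM2l//; lra.
    have : s * b < s * z by rewrite ltr_pM2l.
    lra.
  have conv_lt b y z : y <= b -> z < b -> (1 - s) * y + s * z < b.
    move=> yb zb; have : (1 - s) * y <= (1 - s) * b.
      by rewrite ler_wpM2l//; lra.
    have : s * z < s * b by rewrite ltr_pM2l.
    lra.
  have se : s * (`|mean - x| + 1) < e.
    apply: (@le_lt_trans _ _ (e / 2)); last lra.
    rewrite -ler_pdivlMr// (@le_trans _ _ (e / (2 * (`|mean - x| + 1))))//.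
      by rewrite ge_min lexx orbT.
    by rewrite invfM mulrA.
  exists ((1 - s) * x + s * mean).
  have [i pi xi] := rate_lty_le_atom p_ge0 p_sum1 hx.
  have [j pj xj] := rate_lty_ge_atom p_ge0 p_sum1 hx.
  have [k pk mk] := mean_lt_atom p_ge0 p_sum1 nd.
  have [l pl ml] := atom_lt_mean nd.
  have [||t ht] := @tilt_exists _ _ p a p_ge0 ((1 - s) * x + s * mean).
  (* The smaller of an atom [<= x] and an atom [< mean] lies strictly below the combination, as
     [s > 0]; the next item is the mirror image. *)
  - have [lj|lj] := leP (a l) (a j); [exists l|exists j] => //.
      by apply: lt_conv => //; apply: le_trans xj.
    by apply: lt_conv => //; apply: lt_trans ml.
  - have [lj|lj] := leP (a i) (a k); [exists k|exists i] => //.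
      by apply: conv_lt => //; apply: le_trans lj.
    by apply: conv_lt => //; apply: lt_trans lj.
  exists t; split => //; last by apply: rate_toward_mean => //; lra.
  have -> : (1 - s) * x + s * mean - x = s * (mean - x) by ring.
  rewrite normrM gtr0_norm//; apply: le_lt_trans se.
  by rewrite ler_pM2l// lerDl.
(* In the degenerate case a finite rate forces [x] to be the mean, where [t = 0] is a tilt. *)
exists x, 0; split => //; first by rewrite subrr normr0.
have am i : 0 < p i -> a i = mean.
  by move=> pi; apply/eqP; apply: contrapT => /negP ai; apply: nd; exists i.
suff -> : x = mean by exact: tilted_drift_mean.
apply/eqP; apply: contrapT => /negP/(rate_degenerate am) xoo.
by rewrite xoo ltxx in hx.
Qed.

(** Interior points lie strictly between atoms, so tilts exist. At the tilt [v] of the combination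
    the exponent is affine in the point; it is at most the rate at [y] and strictly below the rate
    at [x], whose tilt differs from [v]. *)
Lemma rate_strictly_convex :
  strictly_convex_on (effective_domain (rate p a))° (rate p a).
Proof.
have gtx x : (effective_domain (rate p a))° x -> exists2 i, 0 < p i & x < a i.
  move=> /nbhs_ballP[e /= e0 xe].
  have /xe/(rate_lty_le_atom p_ge0 p_sum1)[i pi xi] : ball x e (x + e / 2).
    by rewrite /ball/= opprD addrA subrr sub0r normrN gtr0_norm; lra.
  by exists i => //; apply: lt_le_trans xi; rewrite ltrDl divr_gt0.
have ltx x : (effective_domain (rate p a))° x -> exists2 i, 0 < p i & a i < x.
  move=> /nbhs_ballP[e /= e0 xe].
  have /xe/(rate_lty_ge_atom p_ge0 p_sum1)[i pi xi] : ball x e (x - e / 2).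
    by rewrite /ball/= opprB addrC subrK gtr0_norm; lra.
  by exists i => //; apply: le_lt_trans xi _; rewrite ltrBlDr ltrDl divr_gt0.
move=> x y w xS yS xy /andP[w0 w1].
have w01 : 0 <= w <= 1 by rewrite !ltW.
have xl := ltx _ xS; have xg := gtx _ xS; have yl := ltx _ yS; have yg := gtx _ yS.
have zl := exists_atom_lt_conv w01 xl yl.
have zg := exists_atom_gt_conv w01 xg yg.
have [t ht] := tilt_exists p_ge0 xl xg.
have [u hu] := tilt_exists p_ge0 yl yg.
have [v hv] := tilt_exists p_ge0 zl zg.
rewrite (rate_tilt p_ge0 p_sum1 ht) (rate_tilt p_ge0 p_sum1 hu).
rewrite (rate_tilt p_ge0 p_sum1 hv) -!EFinM -EFinD lte_fin.
(* A common tilt would identify [x] with the combination by [tilt_inj], hence with [y] because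
   [w < 1]. *)
have tv : t != v.
  apply/eqP => tv; rewrite tv in ht; have := tilt_inj p_ge0 p_sum1 ht hv.
  by move: xy => /eqP; nra.
have hx := rate_gt_off_tilt p_ge0 p_sum1 ht tv xg.
have hy : - ln (mgf p a y v) <= - ln (mgf p a y u).
  by have := rate_ub p a y v; rewrite (rate_tilt p_ge0 p_sum1 hu).
rewrite (ln_mgf a p_ge0 p_sum1 x v) in hx; rewrite (ln_mgf a p_ge0 p_sum1 y v) in hy.
rewrite (ln_mgf a p_ge0 p_sum1 _ v).
move: hx hy; set L := ln _; set A := - ln _; set B := - ln _ => hx hy.
have -> : v * (w * x + (1 - w) * y) - L =
    w * (v * x - L) + (1 - w) * (v * y - L) by ring.
by rewrite ltr_leD// ?ltr_pM2l// ler_wpM2l// subr_ge0 ltW.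
Qed.

(** The sublevel set is an intersection of closed sets cut out by affine inequalities, and it is
    bounded because a finite rate places [z] between two atoms. *)
Lemma compact_rate_sublevel (c : R) :
  compact [set z | (rate p a z <= c%:E)%E].
Proof.
pose M := \sum_i `|a i|.
have aM i : `|a i| <= M.
  by rewrite /M (bigD1 i)//= lerDl; apply: sumr_ge0 => j _.
apply: (@subclosed_compact _ _ `[- M, M]).
- have -> : [set z | (rate p a z <= c%:E)%E] =
      \bigcap_t [set z | t * z - ln (mgf p a 0 t) <= c].
    apply/seteqP; split => z /=.
      by move=> /rate_leP h t _ /=; rewrite -ln_mgf.
    by move=> h; apply/rate_leP => t; rewrite ln_mgf//; exact: h.
  apply: closed_bigI => t _.
  apply: (@preimage_closed _ _ (fun z => t * z - ln (mgf p a 0 t)) [set y | y <= c]).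
    move=> z _; apply: cvgB; last exact: cvg_cst.
    by apply: cvgM; [exact: cvg_cst|exact: cvg_id].
  exact: closed_le.
- exact: segment_compact.
move=> z /= hz.
have {}hz : (rate p a z < +oo)%E by apply: le_lt_trans hz _; rewrite ltry.
have [i pi xi] := rate_lty_le_atom p_ge0 p_sum1 hz.
have [j pj xj] := rate_lty_ge_atom p_ge0 p_sum1 hz.
rewrite in_itv/=; apply/andP; split.
  by apply: le_trans xj; have := aM j; rewrite ler_norml => /andP[].
by apply: le_trans xi _; exact: le_trans (ler_norm _) (aM i).
Qed.

End RateShape.

(** * Product weights on words of length [n]: Chernoff, Chebyshev and change of measure *)

Definition weight (R : realType) (m n : nat) (q : 'I_m -> R)
    (v : {ffun 'I_n -> 'I_m}) : R := \prod_k q (v k).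

Section Words.
Variables (R : realType) (m : nat).
Implicit Types (p q a y F : 'I_m -> R) (n : nat).

Lemma sum_weight F n : \sum_(v : {ffun 'I_n -> 'I_m}) weight F v = (\sum_i F i) ^+ n.
Proof.
by rewrite -(bigA_distr_bigA (fun=> F)) prodr_const card_ord.
Qed.

Lemma weight_ge0 q n (v : {ffun 'I_n -> 'I_m}) : (forall i, 0 <= q i) ->
  0 <= weight q v.
Proof. by move=> q0; apply: prodr_ge0. Qed.

Lemma weight_tilt p a z t n (v : {ffun 'I_n -> 'I_m}) :
  weight (fun i => p i * expR (t * (a i - z))) v =
  weight p v * expR (t * \sum_k (a (v k) - z)).
Proof. by rewrite /weight big_split/= -expR_sum mulr_sumr. Qed.

(** On [E] the tilting factor is at least [1], and the tilted weights of all words sum to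
    [mgf p a z t ^+ n]. *)
Lemma chernoff_weight p a z t n (E : pred {ffun 'I_n -> 'I_m}) :
  (forall i, 0 <= p i) -> (forall v, E v -> 0 <= t * \sum_k (a (v k) - z)) ->
  \sum_(v | E v) weight p v <= mgf p a z t ^+ n.
Proof.
move=> p0 hE; rewrite /mgf -sum_weight [leRHS](bigID E)/=.
rewrite -[leLHS]addr0 lerD//; last first.
  by apply: sumr_ge0 => v _; apply: weight_ge0 => i; rewrite mulr_ge0 ?expR_ge0.
apply: ler_sum => v Ev; rewrite weight_tilt -[leLHS]mulr1 ler_wpM2l ?weight_ge0//.
by rewrite -expR0 ler_expR hE.
Qed.

(** Expanding the square gives the mixed moments [c k l]; off the diagonal each factorises with a
    factor equal to the zero mean. *)
Lemma second_moment q y n : \sum_i q i = 1 -> \sum_i q i * y i = 0 ->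
  \sum_(v : {ffun 'I_n -> 'I_m}) weight q v * (\sum_k y (v k)) ^+ 2 =
  n%:R * \sum_i q i * y i ^+ 2.
Proof.
move=> q1 qy.
pose c k l := \sum_(v : {ffun 'I_n -> 'I_m}) weight q v * (y (v k) * y (v l)).
have -> : \sum_(v : {ffun 'I_n -> 'I_m}) weight q v * (\sum_k y (v k)) ^+ 2 =
    \sum_k \sum_l c k l.
  under eq_bigr do rewrite expr2 big_distrlr/= mulr_sumr.
  rewrite exchange_big; apply: eq_bigr => k _.
  under eq_bigr do rewrite mulr_sumr.
  by rewrite exchange_big.
(* Padding by [1] writes [y (v k)] as a product over all coordinates, so that sum and product can be
   exchanged. *)
pose h (k j : 'I_n) (i : 'I_m) := if j == k then y i else 1.
have cE k l : c k l = \prod_j \sum_i q i * (h k j i * h l j i).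
  rewrite (bigA_distr_bigA (fun j i => q i * (h k j i * h l j i))).
  apply: eq_bigr => v _; rewrite !big_split/=; congr (_ * (_ * _)).
    by rewrite -big_mkcond big_pred1_eq.
  by rewrite -big_mkcond big_pred1_eq.
have c0 k l : k != l -> c k l = 0.
  move=> kl; rewrite cE (bigD1 k)//= [X in X * _](_ : _ = 0) ?mul0r// -[RHS]qy.
  by apply: eq_bigr => i _; rewrite /h eqxx (negbTE kl) mulr1.
have c1 k : c k k = \sum_i q i * y i ^+ 2.
  rewrite cE (bigD1 k)//= [X in _ * X]big1 ?mulr1.
    by apply: eq_bigr => i _; rewrite /h eqxx expr2.
  move=> j jk; rewrite -[RHS]q1; apply: eq_bigr => i _.
  by rewrite /h (negbTE jk) !mulr1.
under eq_bigr => k _.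
  rewrite (bigD1 k)//= big1 ?addr0 ?c1; last by move=> l lk; rewrite c0// eq_sym.
  over.
by rewrite sumr_const card_ord mulr_natl.
Qed.

Lemma chebyshev_weight q y (e : R) n : (forall i, 0 <= q i) ->
  \sum_i q i = 1 -> \sum_i q i * y i = 0 -> 0 <= e ->
  (n%:R * e) ^+ 2 *
    \sum_(v : {ffun 'I_n -> 'I_m} | n%:R * e <= `|\sum_k y (v k)|) weight q v <=
  n%:R * \sum_i q i * y i ^+ 2.
Proof.
move=> q0 q1 qy e0; rewrite -second_moment// mulr_sumr.
rewrite [leRHS](bigID (fun v : {ffun 'I_n -> 'I_m} => n%:R * e <= `|\sum_k y (v k)|))/=.
rewrite -[leLHS]addr0 lerD//; last first.
  by apply: sumr_ge0 => v _; rewrite mulr_ge0 ?weight_ge0 ?sqr_ge0.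
apply: ler_sum => v hv; rewrite mulrC ler_wpM2l ?weight_ge0//.
by rewrite -[leRHS]real_normK ?num_real// ler_pXn2r// nnegrE ?mulr_ge0.
Qed.

Lemma tilted_lower_bound p a z t (e : R) : (forall i, 0 <= p i) ->
  \sum_i p i = 1 -> tilted_drift p a z t = 0 -> 0 < e ->
  exists N, forall n, (N <= n)%N ->
    (mgf p a z t * expR (- (`|t| * e))) ^+ n / 2 <=
    \sum_(v : {ffun 'I_n -> 'I_m} | `|\sum_k (a (v k) - z)| < n%:R * e) weight p v.
Proof.
move=> p0 p1 ht e0; set M := mgf p a z t.
have M0 : 0 < M by exact: mgf_gt0.
pose q i := p i * expR (t * (a i - z)) / M.
pose y i := a i - z.
have q0 i : 0 <= q i by rewrite divr_ge0 ?mulr_ge0 ?expR_ge0 ?(ltW M0).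
have q1 : \sum_i q i = 1 by rewrite /q -mulr_suml divff ?gt_eqF.
have qy : \sum_i q i * y i = 0.
  suff -> : \sum_i q i * y i = tilted_drift p a z t / M by rewrite ht mul0r.
  rewrite mulr_suml; apply: eq_bigr => i _.
  by rewrite /q /y; ring.
(* Beyond this threshold the Chebyshev bound, variance over [n * e ^+ 2], drops below [1 / 2]. *)
have [N hN] : exists N : nat, 2 * (\sum_i q i * y i ^+ 2) / e ^+ 2 < N%:R.
  exists (Num.truncn (2 * (\sum_i q i * y i ^+ 2) / e ^+ 2)).+1.
  exact: Num.Theory.truncnS_gt.
exists N.+1 => n Nn.
have n0 : 0 < n%:R :> R by rewrite ltr0n; exact: leq_trans Nn.
have weightE (v : {ffun 'I_n -> 'I_m}) :
    weight p v = M ^+ n * (weight q v * expR (- (t * \sum_k y (v k)))).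
  have -> : weight q v = weight p v * expR (t * \sum_k y (v k)) / M ^+ n.
    by rewrite -weight_tilt /weight big_split/= prodr_const card_ord exprVn.
  rewrite expRN; field.
  by rewrite ?expf_neq0 ?(gt_eqF M0)// gt_eqF// expR_gt0.
pose E (v : {ffun 'I_n -> 'I_m}) := `|\sum_k y (v k)| < n%:R * e.
have bad : \sum_(v : {ffun 'I_n -> 'I_m} | ~~ E v) weight q v <= 1 / 2.
  have := chebyshev_weight n q0 q1 qy (ltW e0).
  under eq_bigl do rewrite leNgt.
  set B := \sum_(v | _) _ => hB.
  have B0 : 0 <= B by apply: sumr_ge0 => v _; exact: weight_ge0.
  move: hB hN; set V := \sum_i _.
  rewrite ltr_pdivrMr ?exprn_gt0// exprMn [n%:R ^+ 2]expr2 -!mulrA ler_pM2l// => hB hN.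
  have Nn' : N%:R * e ^+ 2 <= n%:R * e ^+ 2.
    by rewrite ler_pM2r ?exprn_gt0// ler_nat ltnW.
  rewrite leNgt; apply/negP => B1.
  have : n%:R * e ^+ 2 * (1 / 2) < n%:R * (e ^+ 2 * B).
    by rewrite mulrA ltr_pM2l// mulr_gt0// exprn_gt0.
  lra.
have good : 1 / 2 <= \sum_(v | E v) weight q v.
  have := sum_weight q n; rewrite q1 expr1n (bigID E)/=; lra.
apply: (@le_trans _ _ (\sum_(v | E v) M ^+ n * (weight q v * expR (- (`|t| * e)) ^+ n))).
  rewrite -mulr_sumr -mulr_suml exprMn -mulrA ler_wpM2l ?exprn_ge0 ?(ltW M0)//.
  by rewrite mulrC -[2^-1]mul1r ler_wpM2r// exprn_ge0// expR_ge0.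
apply: ler_sum => v Ev; rewrite weightE.
rewrite ler_wpM2l ?exprn_ge0 ?(ltW M0)// ler_wpM2l ?weight_ge0//.
rewrite -expRM_natl ler_expR mulrN lerN2 mulrCA.
rewrite (le_trans (ler_norm _))// normrM ler_wpM2l//.
exact: ltW.
Qed.

End Words.

(** * Bounds on limits in the extended reals *)

Lemma le_ereal_real (R : realType) (x y : \bar R) :
  (forall c : R, (c%:E < x)%E -> (c%:E <= y)%E) -> (x <= y)%E.
Proof.
case: x => [r| |] h; last by rewrite leNye.
  apply/lee_subgt0Pr => e e0; rewrite -EFinB; apply: h.
  by rewrite lte_fin gtrBl.
by rewrite leye_eq; apply/eqP/eqyP => r r0; apply: h; rewrite ltry.
Qed.

Lemma limn_esup_le (R : realType) (u : nat -> \bar R) (c : R) :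
  (forall e : R, 0 < e -> exists N, forall n, (N <= n)%N -> (u n <= (c + e)%:E)%E) ->
  (limn_esup u <= c%:E)%E.
Proof.
move=> h; apply/lee_addgt0Pr => e e0; have [N hN] := h e e0.
apply: (@le_trans _ _ (ereal_sup [set u x | x in [set n | (N <= n)%N]])).
  apply: ereal_inf_lbound; exists [set n | (N <= n)%N] => //.
  by exists N.
by apply: ge_ereal_sup => _ [n /= Nn <-]; exact: hN.
Qed.

Lemma limn_einf_ge (R : realType) (u : nat -> \bar R) (c : R) :
  (forall e : R, 0 < e -> exists N, forall n, (N <= n)%N -> ((c - e)%:E <= u n)%E) ->
  (c%:E <= limn_einf u)%E.
Proof.
move=> h; rewrite leeNr -EFinN; apply: limn_esup_le => e /h[N hN].
by exists N => n /hN; rewrite leeNl -EFinN opprD opprK.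
Qed.

(** Absorbs the constants [2] and [1 / 2] of the two Cramer bounds, which contribute [ln 2 / n]; it
    also discards [n = 0]. *)
Lemma eventually_inv_le (R : realType) (x e : R) : 0 < e ->
  exists N, forall n, (N <= n)%N -> (0 < n)%N /\ n%:R^-1 * x <= e.
Proof.
move=> e0; exists (Num.truncn (`|x| / e)).+1 => n Nn.
have n0 : (0 < n)%N by exact: leq_trans Nn.
split => //; rewrite mulrC ler_pdivrMr ?ltr0n//.
have : `|x| / e < n%:R.
  by apply: lt_le_trans (truncnS_gt _) _; rewrite ler_nat.
rewrite ltr_pdivrMr// mulrC => /ltW; apply: le_trans; exact: ler_norm.
Qed.

(** Closure in the usual topology of [R], in metric form, which keeps the Cramer bounds free of the
    subspace topology. *)
Definition adherent (R : realType) (S : set R) (z : R) : Prop :=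
  forall e, 0 < e -> exists2 y, S y & `|y - z| < e.

(** * The law of the first [n] indices *)

Section IidWords.
Variables (R : realType) (dO : measure_display) (Omega : measurableType dO).
Variables (P : probability Omega R) (m : nat) (p : 'I_m -> R).
Variable idx : nat -> Omega -> 'I_m.
Hypothesis idx_iid : iid_indices P p idx.

Let word n w : {ffun 'I_n -> 'I_m} := [ffun k : 'I_n => idx k w].

(** Puts the event in the form required by [mutually_independent], with natural numbers as indices;
    the quantifier over [j] converts [k] back to an ordinal. *)
Lemma preimage_word1 n (v : {ffun 'I_n -> 'I_m}) :
  word n @^-1` [set v] = \bigcap_(k in [set` iota 0 n])
    (idx k @^-1` [set i | forall j : 'I_n, j = k :> nat -> i = v j]).
Proof.
apply/seteqP; split => w /=.
  by move=> <- k _ j /= jk; rewrite ffunE jk.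
move=> h; apply/ffunP => k; rewrite ffunE; apply: (h k) => //=.
by rewrite mem_iota add0n leq0n ltn_ord.
Qed.

Lemma measurable_word1 n (v : {ffun 'I_n -> 'I_m}) :
  measurable (word n @^-1` [set v]).
Proof.
have [hm _ _] := idx_iid.
rewrite preimage_word1; apply: fin_bigcap_measurable => //.
by move=> k _; exact: hm.
Qed.

Lemma prob_word1 n (v : {ffun 'I_n -> 'I_m}) :
  P (word n @^-1` [set v]) = (weight p v)%:E.
Proof.
have [_ ind law] := idx_iid.
rewrite preimage_word1 ind ?iota_uniq//.
have -> : iota 0 n = index_iota 0 n by rewrite /index_iota subn0.
rewrite big_mkord /weight -prodEFin; apply: eq_bigr => k _.
rewrite -(law k); congr (P (_ @^-1` _)); apply/seteqP; split => i /= h; first exact: h.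
by move=> j jk; rewrite h; congr (v _); exact: val_inj.
Qed.

Lemma prob_words n (E : pred {ffun 'I_n -> 'I_m}) :
  P [set w | E (word n w)] = (\sum_(v | E v) weight p v)%:E.
Proof.
have -> : [set w | E (word n w)] =
    \bigcup_(v in [set` enum E]) (word n @^-1` [set v]).
  apply/seteqP; split => w /=.
    by move=> Ew; exists (word n w) => //=; rewrite mem_enum.
  by move=> [v /=]; rewrite mem_enum => Ev ->.
rewrite measure_fin_bigcup//.
- rewrite -fsbig_seq ?enum_uniq// big_enum/= -sumEFin.
  by apply: eq_bigr => v _; rewrite prob_word1.
- by move=> u v _ _ [w [/= <- <-]].
- by move=> v _; exact: measurable_word1.
Qed.

End IidWords.

(** * Cramer's bounds for averages over words *)

Definition average (R : realType) (m n : nat) (a : 'I_m -> R)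
    (v : {ffun 'I_n -> 'I_m}) : R := n%:R^-1 * \sum_k a (v k).

Lemma sum_center (R : realType) (m n : nat) (a : 'I_m -> R) z
    (v : {ffun 'I_n -> 'I_m}) : (0 < n)%N ->
  \sum_k (a (v k) - z) = n%:R * (average a v - z).
Proof.
move=> n0; rewrite sumrB sumr_const card_ord /average mulrBr mulrA divff ?mul1r ?mulr_natl//.
by rewrite pnatr_eq0 -lt0n.
Qed.

(** The infimum [b] of [S] is adherent to [S], so some exponent at [b] exceeds [c]; Chernoff applies
    at [b] because [S] lies to its right. *)
Lemma cramer_upper_right (R : realType) (m n : nat) (p a : 'I_m -> R)
    (S : set R) (c : R) :
  (forall i, 0 <= p i) -> \sum_i p i = 1 -> (0 < n)%N ->
  (forall z, S z -> \sum_i p i * a i <= z) ->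
  (forall z, adherent S z -> (c%:E < rate p a z)%E) ->
  \sum_(v : {ffun 'I_n -> 'I_m} | `[< S (average a v) >]) weight p v <=
    expR (- c) ^+ n.
Proof.
move=> p0 p1 n0 Smean Sc; set mean := \sum_i _ in Smean.
have [->|/set0P S0] := eqVneq S set0.
  rewrite big_pred0 ?exprn_ge0 ?expR_ge0// => v.
  by apply/negbTE/negP => /asboolP.
have infS : has_inf S by split => //; exists mean.
pose b := inf S.
have bS z : S z -> b <= z by apply: ge_inf; exact: infS.2.
have meanb : mean <= b by exact: lb_le_inf.
have adb : adherent S b.
  move=> e e0; have [y Sy yb] := inf_adherent e0 infS.
  by exists y => //; rewrite ger0_norm ?subr_ge0 ?bS// ltrBlDl.
have [t t0 ct] : exists2 t, 0 <= t & c < - ln (mgf p a b t).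
  have [t ct] := rate_gtP (Sc _ adb); have [t0|t0] := leP 0 t; first by exists t.
  (* For [t < 0] the exponent at [b >= mean] is at most the one at the mean, hence at most [0]; so
     [c < 0] and the parameter [0] serves. *)
  exists 0 => //; rewrite mgf0// ln1 oppr0; apply: lt_le_trans ct _.
  have := rate_ub p a mean t; rewrite rate_mean// lee_fin; apply: le_trans.
  by rewrite (ln_mgf a p0 p1 b) (ln_mgf a p0 p1 mean) lerD2r ler_nM2l.
apply: (@le_trans _ _ (mgf p a b t ^+ n)).
  apply: chernoff_weight => // v /asboolP Sv.
  by rewrite sum_center// !mulr_ge0// subr_ge0 bS.
rewrite lerXn2r ?nnegrE ?expR_ge0 ?(ltW (mgf_gt0 _ _ _ _ _))//.
rewrite -[leLHS]lnK ?posrE ?mgf_gt0// ler_expR; lra.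
Qed.

(** [S] is cut at the mean; the left piece is handled by the reflection [a |-> - a], and the two
    pieces account for the factor [2]. *)
Lemma cramer_upper (R : realType) (m n : nat) (p a : 'I_m -> R) (S : set R) (c : R) :
  (forall i, 0 <= p i) -> \sum_i p i = 1 -> (0 < n)%N ->
  (forall z, adherent S z -> (c%:E < rate p a z)%E) ->
  \sum_(v : {ffun 'I_n -> 'I_m} | `[< S (average a v) >]) weight p v <=
    2 * expR (- c) ^+ n.
Proof.
move=> p0 p1 n0 Sc; set mean := \sum_i p i * a i.
pose aN i := - a i.
have meanN : \sum_i p i * aN i = - mean.
  by under eq_bigr do rewrite mulrN; rewrite sumrN.
have avgN v : average aN v = - average (n := n) a v.
  by rewrite /average sumrN mulrN.
have := @cramer_upper_right _ _ n p a [set z | S z /\ mean <= z] c p0 p1 n0.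
have := @cramer_upper_right _ _ n p aN [set z | S (- z) /\ - mean <= z] c p0 p1 n0.
rewrite meanN => /(_ (fun z => @proj2 _ _)) hL /(_ (fun z => @proj2 _ _)) hR.
have {}hL := hL _; have {}hR := hR _.
rewrite mulr_natl mulr2n; apply: le_trans (lerD (hL _) (hR _)); last 2 first.
- move=> z zS; rewrite -(opprK z) rate_opp; apply: Sc => e /zS[y [Sy _] yz].
  by exists (- y) => //; rewrite -opprD normrN.
- by move=> z zS; apply: Sc => e /zS[y [Sy _] yz]; exists y.
rewrite big_mkcond [X in _ <= X + _]big_mkcond [X in _ <= _ + X]big_mkcond/=.
rewrite -big_split/=; apply: ler_sum => v _.
have w0 : 0 <= weight p v by exact: weight_ge0.
rewrite avgN opprK lerN2.
case: asboolP => Sv; last by rewrite addr_ge0//; case: ifP.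
have [vm|vm] := leP (average a v) mean.
  by rewrite asboolT// lerDl; case: ifP.
by rewrite addrC asboolT ?lerDl; [case: ifP|split => //; exact: ltW].
Qed.

(** [tilt_near_rate] replaces [z] by a point [x] within [d / 2] that has a tilt and no larger rate;
    the averages are then concentrated near [x]. *)
Lemma cramer_lower (R : realType) (m : nat) (p a : 'I_m -> R) (S : set R)
    (z e d : R) :
  (forall i, 0 <= p i) -> \sum_i p i = 1 -> (rate p a z < +oo)%E ->
  0 < e -> 0 < d -> (forall y, `|y - z| < d -> S y) ->
  exists N, forall n, (N <= n)%N ->
    expR (- (fine (rate p a z) + e)) ^+ n / 2 <=
    \sum_(v : {ffun 'I_n -> 'I_m} | `[< S (average a v) >]) weight p v.
Proof.
move=> p0 p1 hz e0 d0 dS.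
have d20 : 0 < d / 2 by rewrite divr_gt0.
have [x [t [xz xr ht]]] := tilt_near_rate p0 p1 d20 hz.
(* The first bound keeps averages within [d] of [z], the second keeps the tilting cost [|t| * e']
   below [e]. *)
pose e' := Num.min (d / 2) (e / (`|t| + 1)).
have t10 : 0 < `|t| + 1 by rewrite ltr_wpDl.
have e'0 : 0 < e' by rewrite lt_min d20 divr_gt0.
have e'd : e' <= d / 2 by rewrite ge_min lexx.
have te : `|t| * e' <= e.
  apply: (@le_trans _ _ ((`|t| + 1) * e')); first by rewrite ler_wpM2r ?(ltW e'0)// lerDl.
  by rewrite mulrC -ler_pdivlMr// ge_min lexx orbT.
have [N hN] := tilted_lower_bound p0 p1 ht e'0.
exists N.+1 => n Nn; have n0 : (0 < n)%N by exact: leq_trans Nn.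
have n0' : 0 < n%:R :> R by rewrite ltr0n.
apply: (@le_trans _ _ ((mgf p a x t * expR (- (`|t| * e'))) ^+ n / 2)).
  rewrite ler_pM2r// lerXn2r ?nnegrE ?mulr_ge0 ?expR_ge0 ?(ltW (mgf_gt0 _ _ _ _ _))//.
  rewrite opprD expRD ler_pM ?expR_ge0// ?ler_expR ?lerN2//.
  rewrite -[leRHS]lnK ?posrE ?mgf_gt0// ler_expR lerNl.
  by rewrite -lee_fin -rate_fin// -(rate_tilt p0 p1 ht).
apply: le_trans (hN n (ltnW Nn)) _.
rewrite big_mkcond [leRHS]big_mkcond/=; apply: ler_sum => v _.
case: ifP => [h|_]; last by case: ifP => // _; exact: weight_ge0.
rewrite asboolT//; apply: dS.
move: h; rewrite sum_center// normrM gtr0_norm// ltr_pM2l// => h.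
have -> : average a v - z = (average a v - x) + (x - z) by ring.
by apply: le_lt_trans (ler_normD _ _) _; lra.
Qed.

(** * Transfer to the half-line through [expR]: large deviation principle and good rate function *)

Lemma nbhs_subspace_within (T : topologicalType) (A : set T) (x : T) : A x ->
  nbhs (x : subspace A) = within A (nbhs x).
Proof. by move=> Ax; symmetry; exact: (@nbhs_subspace_in T A x Ax). Qed.

Lemma nbhs_subspace_globally (T : topologicalType) (A : set T) (x : T) : ~ A x ->
  nbhs (x : subspace A) = globally [set x].
Proof. by move=> Ax; symmetry; exact: (@nbhs_subspace_out T A x Ax). Qed.

Section LDP.
Variables (R : realType) (dO : measure_display) (Omega : measurableType dO).
Variables (P : probability Omega R) (m : nat) (p a : 'I_m -> R).
Variables (idx : nat -> Omega -> 'I_m) (X : nat -> Omega -> R).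
Hypothesis idx_iid : iid_indices P p idx.
Hypotheses (p_ge0 : forall i, 0 <= p i) (p_sum1 : \sum_i p i = 1).
Hypothesis XE : forall n w, (0 < n)%N ->
  X n w = expR (n%:R^-1 * \sum_(k < n) a (idx k w)).

Lemma prob_average n (B : set R) : (0 < n)%N ->
  P (X n @^-1` B) =
  (\sum_(v : {ffun 'I_n -> 'I_m} | `[< (expR @^-1` B) (average a v) >]) weight p v)%:E.
Proof.
move=> n0; rewrite -(prob_words idx_iid); congr (P _).
apply/seteqP; split => w /=; rewrite XE// => h.
  apply/asboolP; rewrite /average.
  by under eq_bigr do rewrite ffunE.
move: h => /asboolP; rewrite /average.
by under eq_bigr do rewrite ffunE.
Qed.

Lemma subspace_closure_expR (B : set R) z : adherent (expR @^-1` B) z ->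
  @closure (subspace (`]0, +oo[%classic : set R)) B (expR z).
Proof.
move=> az U; rewrite nbhs_subspace_within; last by rewrite /= in_itv/= expR_gt0.
move=> /(@continuous_expR R z)/nbhs_ballP[e /= e0 eU].
have [y By yz] := az e e0.
exists (expR y); split => //; apply: (eU y).
  by rewrite /ball/= distrC.
by rewrite /= in_itv/= expR_gt0.
Qed.

Lemma subspace_interior_expR (B : set R) r : 0 < r ->
  @interior (subspace (`]0, +oo[%classic : set R)) B r ->
  exists2 d, 0 < d & forall y, `|y - ln r| < d -> B (expR y).
Proof.
move=> r0; rewrite /interior nbhs_subspace_within; last by rewrite /= in_itv/= r0.
rewrite -{1}(@lnK _ r) ?posrE//.
move=> /(@continuous_expR R (ln r))/nbhs_ballP[e /= e0 eU].
exists e => // y hy; apply: (eU y).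
  by rewrite /ball/= distrC.
by rewrite /= in_itv/= expR_gt0.
Qed.

Lemma cramer_ldp :
  large_deviation_principle P `]0, +oo[ X (fun n => n%:R)
    (fun r => rate p a (ln r)).
Proof.
move=> B mB B0 u; split; last 2 first.
- exact: limn_einf_sup.
(* Working with real [c] below the infimum covers an infinite infimum and gives the strict
   inequality that [cramer_upper] expects. *)
- rewrite leeNr; apply: le_ereal_real => c cI; rewrite leeNr -EFinN.
  have Bc z : adherent (expR @^-1` B) z -> (c%:E < rate p a z)%E.
    move=> /subspace_closure_expR Bz; apply: lt_le_trans cI _.
    by apply: ereal_inf_lbound; exists (expR z) => //; rewrite expRK.
  apply: limn_esup_le => e e0.
  have [N hN] := eventually_inv_le (ln 2) e0.
  exists N => n /hN[n0 ne]; rewrite /u prob_average//.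
  have n0' : 0 < n%:R :> R by rewrite ltr0n.
  have := cramer_upper p_ge0 p_sum1 n0 Bc.
  set S := \sum_(_ | _) _ => hS.
  (* An event of probability zero has logarithm [-oo], and the bound is trivial. *)
  have [S0|S0] := leP S 0.
    rewrite le0_lneNy ?lee_fin// mulrNy gtr0_sg ?invr_gt0// mul1e.
    by rewrite leNye.
  rewrite lne_EFin// -EFinM lee_fin.
  have : ln S <= ln 2 - n%:R * c.
    rewrite -[leRHS]expRK ler_ln ?posrE ?expR_gt0//.
    by rewrite expRD lnK ?posrE// -mulrN expRM_natl.
  have i0 : 0 <= n%:R^-1 :> R by rewrite invr_ge0 ltW.
  move=> /(ler_wpM2l i0)/le_trans; apply.
  rewrite mulrBr mulrA mulVf ?gt_eqF// mul1r; lra.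
(* Lower bound: it suffices to treat each interior point [r] separately, and only those of finite
   rate. *)
rewrite leeNl; apply: le_ereal_inf_tmp => _ [r rB <-].
have r0 : 0 < r.
  have : B r by exact: (@nbhs_singleton (subspace (`]0, +oo[%classic : set R))).
  by move=> /B0; rewrite /= in_itv/= andbT.
have [->|rfin] := eqVneq (rate p a (ln r)) +oo%E; first by rewrite leey.
have {}rfin : (rate p a (ln r) < +oo)%E by rewrite ltey.
rewrite rate_fin// leeNl -EFinN; apply: limn_einf_ge => e e0.
have [d d0 dB] := subspace_interior_expR r0 rB.
have e20 : 0 < e / 2 by rewrite divr_gt0.
have [N1 hN1] := cramer_lower p_ge0 p_sum1 rfin e20 d0 dB.
have [N2 hN2] := eventually_inv_le (ln 2) e20.
exists (maxn N1 N2) => n; rewrite geq_max => /andP[/hN1 nS /hN2[n0 ne]].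
rewrite /u prob_average//.
move: nS; set S := \sum_(_ | _) _; set c := fine _ => nS.
have n0' : 0 < n%:R :> R by rewrite ltr0n.
have S0 : 0 < S by apply: lt_le_trans nS; rewrite divr_gt0// exprn_gt0// expR_gt0.
rewrite lne_EFin// -EFinM lee_fin.
have : - (n%:R * (c + e / 2)) - ln 2 <= ln S.
  rewrite -[leLHS]expRK ler_ln ?posrE ?expR_gt0//.
  by rewrite expRD -mulrN expRM_natl expRN lnK ?posrE.
have i0 : 0 <= n%:R^-1 :> R by rewrite invr_ge0 ltW.
move=> /(ler_wpM2l i0); apply: le_trans.
rewrite mulrBr mulrN mulrA mulVf ?gt_eqF// mul1r; lra.
Qed.

(** One exponent already exceeds [c], and it is continuous in [r]: a supremum of continuous
    functions is lower semicontinuous. *)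
Lemma nbhs_rate_log (r c : R) : 0 < r -> (c%:E < rate p a (ln r))%E ->
  nbhs r [set y | (c%:E < rate p a (ln y))%E].
Proof.
move=> r0 /rate_gtP[t]; rewrite ln_mgf// => ct.
have cont : (fun y => t * ln y - ln (mgf p a 0 t)) @ r -->
    t * ln r - ln (mgf p a 0 t).
  apply: cvgB; last exact: cvg_cst.
  by apply: cvgM; [exact: cvg_cst|exact: continuous_ln].
apply: filterS (cvgr_gt _ cont _ ct) => y cy.
by apply: lt_le_trans (rate_ub p a (ln y) t); rewrite lte_fin ln_mgf.
Qed.

Lemma rate_good_log : good_rate_function `]0, +oo[ (fun r => rate p a (ln r)).
Proof.
split.
- by move=> r _; exact: rate_ge0.
- move=> r c cr; have [r0|r0] := ltP (0 : R) r; last first.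
    (* A point outside the half-line is isolated in the subspace topology. *)
    exists [set r]; last by move=> y ->.
    rewrite nbhs_subspace_globally; first by move=> y ->.
    by rewrite /= in_itv/= andbT; apply/negP; rewrite -leNgt.
  exists [set y | (c%:E < rate p a (ln y))%E]; last by [].
  rewrite nbhs_subspace_within; last by rewrite /= in_itv/= r0.
  by apply: filterS (nbhs_rate_log r0 cr) => y hy _.
move=> c.
have -> : [set x | `]0, +oo[%classic x /\ (rate p a (ln x) <= c%:E)%E] =
    expR @` [set z | (rate p a z <= c%:E)%E].
  apply/seteqP; split => x /=.
    rewrite in_itv/= andbT => -[x0 hx]; exists (ln x) => //.
    by rewrite lnK ?posrE.
  by move=> [z hz <-]; rewrite in_itv/= expR_gt0 expRK.
apply: continuous_compact; last exact: compact_rate_sublevel.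
exact/continuous_subspaceT/continuous_expR.
Qed.

End LDP.

(** * Triangular products and their spectral radius *)

Lemma trig_mulmx (K : comNzRingType) (d : nat) (A B : 'M[K]_d) :
  is_trig_mx A -> is_trig_mx B ->
  is_trig_mx (A *m B) /\ forall j, (A *m B) j j = A j j * B j j.
Proof.
move=> /is_trig_mxP tA /is_trig_mxP tB; split.
  apply/is_trig_mxP => i j ij; rewrite mxE big1// => k _.
  have [ik|ki] := ltnP i k; first by rewrite tA// mul0r.
  by rewrite tB ?mulr0// (leq_ltn_trans ki).
move=> j; rewrite mxE (bigD1 j)//= big1 ?addr0// => k kj.
have [jk|] := ltnP j k; first by rewrite tA// mul0r.
rewrite leq_eqVlt => /orP[/eqP/val_inj kjE|lt]; first by rewrite kjE eqxx in kj.
by rewrite tB ?mulr0.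
Qed.

(** Reduces the spectrum of upper triangular matrices to the lower triangular case. *)
Lemma char_poly_tr (K : comNzRingType) (d : nat) (A : 'M[K]_d) :
  char_poly A^T = char_poly A.
Proof.
rewrite /char_poly -[in RHS]det_tr; congr (\det _).
by apply/matrixP => i j; rewrite !mxE eq_sym.
Qed.

Section SpectralRadius.
Variables (R : realType) (d : nat).

Lemma eigenvalue_trig (A : 'M[R[i]]_d) (z : R[i]) :
  is_trig_mx A^T \/ is_trig_mx A ->
  eigenvalue A z <-> exists j, z = A j j.
Proof.
move=> trA; have -> : eigenvalue A z = (z \in [seq A j j | j : 'I_d]).
  rewrite eigenvalue_root_char -root_prod_XsubC big_map big_enum /=.
  case: trA => [tr|/char_poly_trig->//].
  rewrite -char_poly_tr (char_poly_trig tr).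
  by congr (root _ z); apply: eq_bigr => j _; rewrite mxE.
split=> [/mapP[j _ ->]|[j ->]]; first by exists j.
by apply: map_f; rewrite mem_enum.
Qed.

Lemma spectral_radius_trig (A : 'M[R[i]]_d) (j : 'I_d) :
  is_trig_mx A^T \/ is_trig_mx A ->
  (forall k, modC (A k k) <= modC (A j j)) ->
  spectral_radius A = modC (A j j).
Proof.
move=> trA dom; rewrite /spectral_radius; set S := [set _ | _ in _].
have SA : S (modC (A j j)) by exists (A j j) => //=; apply/eigenvalue_trig => //; exists j.
have ub : ubound S (modC (A j j)).
  by move=> _ [z /= /(eigenvalue_trig _ trA)[k ->] <-]; exact: dom.
apply/eqP; rewrite eq_le ge_sup//=; last by exists (modC (A j j)).
by apply: ub_le_sup => //; exists (modC (A j j)).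
Qed.

Variables (m : nat) (T : 'I_m -> 'M[R[i]]_d) (Omega : Type).
Variable idx : nat -> Omega -> 'I_m.

Lemma random_product_trig n w : (forall i, is_trig_mx (T i)) ->
  is_trig_mx (random_product T idx n w) /\
  forall j, random_product T idx n w j j = \prod_(k < n) T (idx k w) j j.
Proof.
move=> trT; elim: n => [|n [trn IH]].
  split; first exact: scalar_mx_is_trig.
  by move=> j; rewrite big_ord0 mxE eqxx.
have [tr E] := trig_mulmx (trT (idx n w)) trn; split => // j.
by rewrite /= E IH big_ord_recr mulrC.
Qed.

(** Transposition reverses the product, so the new factor now enters on the right. *)
Lemma random_product_trig_tr n w : (forall i, is_trig_mx (T i)^T) ->
  is_trig_mx (random_product T idx n w)^T /\
  forall j, random_product T idx n w j j = \prod_(k < n) T (idx k w) j j.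
Proof.
move=> trT; elim: n => [|n [trn IH]].
  rewrite /= trmx1; split; first exact: scalar_mx_is_trig.
  by move=> j; rewrite big_ord0 mxE eqxx.
have [tr E] := trig_mulmx trn (trT (idx n w)).
rewrite /= trmx_mul; split => // j.
by have := E j; rewrite -trmx_mul !mxE IH big_ord_recr.
Qed.

Lemma modC_ge0 (z : R[i]) : 0 <= modC z.
Proof. by case: z => x y; exact: sqrtr_ge0. Qed.

Lemma modC_prod n (F : 'I_n -> R[i]) : modC (\prod_k F k) = \prod_k modC (F k).
Proof.
by apply: (big_morph (fun z : R[i] => modC z) (@Normc.normcM R)); exact: Normc.normc1.
Qed.

(** Domination of the diagonal moduli is preserved by products, so the entry at [j] gives the
    spectral radius. At [n = 0] both sides are [1]. *)
Lemma random_spectral_radiusE (j : 'I_d) n w :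
  (forall i, is_trig_mx (T i)^T) \/ (forall i, is_trig_mx (T i)) ->
  (forall i k, modC (T i k k) <= modC (T i j j)) ->
  (forall i, 0 < modC (T i j j)) ->
  random_spectral_radius T idx n w =
    expR (n%:R^-1 * \sum_(k < n) ln (modC (T (idx k w) j j))).
Proof.
move=> trT dom pos; rewrite /random_spectral_radius.
have [trn diag] : (is_trig_mx (random_product T idx n w)^T \/
      is_trig_mx (random_product T idx n w)) /\
    forall j, random_product T idx n w j j = \prod_(k < n) T (idx k w) j j.
  by case: trT => [/(random_product_trig_tr n w)|/(random_product_trig n w)] [tr E];
    split => //; [left|right].
rewrite (@spectral_radius_trig _ j)//; last first.
  move=> k; rewrite !diag !modC_prod; apply: ler_prod => l _.
  by rewrite modC_ge0 dom.
rewrite diag modC_prod /powR gt_eqF ?prodr_gt0//; congr expR; congr (_ * _).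
under eq_bigr => k _ do rewrite -[modC _]lnK ?posrE//.
by rewrite -expR_sum expRK.
Qed.

End SpectralRadius.

(** * Back to the Legendre transform, the variable [Z] and the theorem *)

Lemma legendreE (R : realType) (m : nat) (p lam : 'I_m -> R) :
  (forall i, 0 <= p i) -> \sum_i p i = 1 -> (forall i, 0 < lam i) ->
  legendre (log_mgf p lam) = rate p (fun i => ln (lam i)).
Proof.
move=> p0 p1 lam0; apply/funext => z; rewrite /legendre /rate.
congr ereal_sup; apply: eq_imagel => t _.
rewrite ln_mgf// /log_mgf; congr ((_ - ln _)%:E).
by apply: eq_bigr => i _; rewrite /powR gt_eqF// subr0.
Qed.

(** The complement of the almost sure value [c] is null for the law of [Z], so every atom of
    positive mass equals [c], and so does the mean. *)
Lemma degenerate_atoms (R : realType) (m : nat) (p a : 'I_m -> R)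
    (dZ : measure_display) (OmegaZ : measurableType dZ)
    (Q : probability OmegaZ R) (Z : {RV Q >-> R}) :
  (forall i, 0 <= p i) -> \sum_i p i = 1 ->
  (forall A : set R, measurable A ->
    distribution Q Z A = (\sum_(i < m) (p i)%:E * \d_(a i) A)%E) ->
  degenerate Q Z -> forall i, 0 < p i -> a i = \sum_j p j * a j.
Proof.
move=> p0 p1 law [c Zc].
have mc : measurable (~` [set c]) by exact: measurableC.
have Z0 : distribution Q Z (~` [set c]) = 0%E.
  rewrite -[LHS]/(Q (Z @^-1` (~` [set c]))).
  apply: measure_negligible; last exact: Zc.
  by rewrite -[X in measurable X]setTI; exact: measurable_funP.
have ac i : 0 < p i -> a i = c.
  move=> pi; apply: contrapT => aic.
  move: Z0; rewrite law//; under eq_bigr do rewrite diracE -EFinM.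
  rewrite sumEFin => /eqP; rewrite eqe psumr_eq0; last first.
    by move=> k _; rewrite mulr_ge0.
  move=> /allP/(_ i); rewrite mem_index_enum => /(_ isT)/=.
  by rewrite mem_set// mulr1 gt_eqF.
move=> i pi; rewrite ac// -[LHS]mul1r -p1 mulr_suml; apply: eq_bigr => k _.
have [pk|pk] := ltP 0 (p k); first by rewrite ac.
by have -> : p k = 0; [apply/eqP; rewrite eq_le pk p0|rewrite !mul0r].
Qed.

Theorem theorem7 (R : realType) (d m : nat) (T : 'I_m -> 'M[R[i]]_d)
    (p : 'I_m -> R)
    (dO : measure_display) (Omega : measurableType dO)
    (P : probability Omega R) (idx : nat -> Omega -> 'I_m) (jstar : 'I_d)
    (Ttrig : (forall i, is_trig_mx (T i)^T) \/ (forall i, is_trig_mx (T i)))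
    (Tdiag : forall i j, T i j j != 0)
    (p_ge0 : forall i, 0 <= p i) (p_sum1 : \sum_(i < m) p i = 1)
    (idx_iid : iid_indices P p idx)
    (dominant : forall i,
       \big[Num.max/0]_(j < d | j != jstar) modC (T i j j)
         < modC (T i jstar jstar)) :
  let lam := fun i => modC (T i jstar jstar) in
  let rho := random_spectral_radius T idx in
  let Lambda := log_mgf p lam in
  let I := legendre Lambda in
  let Itilde := fun r => I (ln r) in
  let rho_infty := \prod_(i < m) lam i `^ p i in
  [/\ good_rate_function `]0, +oo[ Itilde,
      large_deviation_principle P `]0, +oo[ rho (fun n => n%:R) Itilde,
      forall z, (0 <= I z)%E,
      I (ln rho_infty) = 0%E &
      forall (dZ : measure_display) (OmegaZ : measurableType dZ)
        (Q : probability OmegaZ R) (Z : {RV Q >-> R}),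
        (forall A : set R, measurable A ->
           distribution Q Z A
             = (\sum_(i < m) (p i)%:E * \d_(ln (lam i)) A)%E) ->
        (~ degenerate Q Z -> strictly_convex_on (effective_domain I)° I) /\
        (degenerate Q Z ->
           I (ln rho_infty) = 0%E /\
           forall z, z != ln rho_infty -> I z = +oo%E)].
Proof.
move=> lam rho Lambda I Itilde rho_infty.
have dom i k : modC (T i k k) <= lam i.
  have [->//|kj] := eqVneq k jstar.
  apply: le_trans (ltW (dominant i)).
  exact: (@le_bigmax_cond _ _ _ _ k (fun k => k != jstar) (fun k => modC (T i k k))).
(* The maximum starts from [0], so strict dominance includes positivity, also for [d = 1]. *)
have lam0 i : 0 < lam i.
  by apply: le_lt_trans (dominant i); exact: bigmax_ge_id.
pose a i := ln (lam i).
have IE : I = rate p a by exact: legendreE.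
have meanE : ln rho_infty = \sum_i p i * a i.
  rewrite /rho_infty; under eq_bigr => i _ do rewrite /powR gt_eqF//.
  by rewrite -expR_sum expRK.
have rhoE n w : (0 < n)%N -> rho n w = expR (n%:R^-1 * \sum_(k < n) a (idx k w)).
  by move=> _; exact: random_spectral_radiusE.
have I0 : I (ln rho_infty) = 0%E by rewrite IE meanE rate_mean.
rewrite /Itilde IE in I0 *; split => //.
- exact: rate_good_log.
- exact: (cramer_ldp idx_iid).
- by move=> z; exact: rate_ge0.
move=> dZ OmegaZ Q Z law; split=> [_|deg]; first exact: rate_strictly_convex.
split => // z; rewrite meanE => zm.
by apply: rate_degenerate => //; exact: degenerate_atoms law deg.
Qed.
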